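(* Let $q$ be a prime power. Let $ss_A(n,q)$ (resp. $ss_{GL}(n,q)$) be the probability that a uniform element of $A(n,q)$ (resp. $GL(n,q)$) is semisimple, $SS_A(u,q)=\sum_{n\ge0}ss_A(n,q)u^n$, $SS_{GL}(u,q)=\sum_{n\ge0}ss_{GL}(n,q)u^n$. Then as formal power series \[ SS_A(u,q)=\Bigl(\sum_{k\ge0}\frac{u^k}{q^{k^2+k}(\frac1q)_k}\Bigr)\prod_{d\ge1}\Bigl(\sum_{k\ge0}\frac{u^{kd}}{q^{k^2d}(\frac1{q^d})_k}\Bigr)^{N'(d,q)}=\frac{\sum_{k\ge0}\frac{u^k}{q^{k^2+k}(\frac1q)_k}}{\sum_{k\ge0}\frac{u^k}{q^{k^2}(\frac1q)_k}}\,SS_{GL}(u,q). \]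
   Context: $A(n,q)$ is the group of matrices $x\in GL(n+1,q)$ with $x_{11}=1$ and $x_{j1}=0$ for $j\ge2$, viewed in $GL(n+1,q)$. A matrix is semisimple if it is diagonalizable over the algebraic closure of $\mathbb{F}_q$. $GL(0,q)$ is trivial. $(x)_k=\prod_{j=1}^k(1-x^j)$, $(x)_0=1$. $N(d,q)$ is the number of monic irreducible polynomials of degree $d$ over $\mathbb{F}_q$; $N'(d,q)=N(d,q)$ for $d>1$ and $N'(1,q)=q-2$. *)

(* Defs.v *)
From HB Require Import structures.
From mathcomp Require Import all_boot all_order all_algebra all_field.
From mathcomp Require Import mxred.
From mathcomp Require Import boolp.

Set Implicit Arguments.
Unset Strict Implicit.
Unset Printing Implicit Defensive.

Import GRing.Theory Num.Theory.
Local Open Scope ring_scope.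

Definition alg_closure (F : finFieldType) : closedFieldType :=
  projT1 (countable_algebraic_closure F).

Definition to_closure (F : finFieldType) : {rmorphism F -> alg_closure F} :=
  proj1_sig (projT2 (countable_algebraic_closure F)).

Definition semisimple (F : finFieldType) (n : nat) (x : 'M[F]_n) : Prop :=
  diagonalizable (map_mx (to_closure F) x).

Definition semisimpleb (F : finFieldType) (n : nat) (x : 'M[F]_n) : bool :=
  `[< semisimple x >].

Definition GLset (F : finFieldType) (n : nat) : {set 'M[F]_n} :=
  [set x : 'M[F]_n | x \in unitmx].

(* x in GL(n+1,q) with x_11 = 1 and x_j1 = 0 for j >= 2
   (index 0 is the first row/column). *)
Definition Aset (F : finFieldType) (n : nat) : {set 'M[F]_n.+1} :=
  [set x : 'M[F]_n.+1 | [&& x \in unitmx, x ord0 ord0 == 1 &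
                          [forall j : 'I_n.+1, (j != ord0) ==> (x j ord0 == 0)]]].

Definition ss_GL (F : finFieldType) (n : nat) : rat :=
  #|[set x in GLset F n | semisimpleb x]|%:R / #|GLset F n|%:R.

Definition ss_A (F : finFieldType) (n : nat) : rat :=
  #|[set x in Aset F n | semisimpleb x]|%:R / #|Aset F n|%:R.

Definition monic_of (F : finFieldType) (d : nat) (c : {ffun 'I_d -> F}) : {poly F} :=
  'X^d + \sum_(i < d) (c i)%:P * 'X^i.

Definition Nirr (F : finFieldType) (d : nat) : nat :=
  #|[set c : {ffun 'I_d -> F} | `[< irreducible_poly (monic_of c) >] ]|.

Definition Nirr' (F : finFieldType) (d : nat) : nat :=
  if d == 1%N then (#|F| - 2)%N else Nirr F d.

Definition fps := nat -> rat.

Definition fone : fps := fun n => (n == 0%N)%:R.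

Definition fmul (f g : fps) : fps :=
  fun n => \sum_(i < n.+1) f i * g (n - i)%N.

Definition fpow (f : fps) (k : nat) : fps := iter k (fmul f) fone.

(* coefficients 0..n of the multiplicative inverse (when f 0 != 0) *)
Fixpoint finv_seq (f : fps) (n : nat) : seq rat :=
  match n with
  | 0 => [:: (f 0%N)^-1]
  | n'.+1 => let s := finv_seq f n' in
      rcons s (- (f 0%N)^-1 * \sum_(i < n'.+1) f i.+1 * nth 0 s (n' - i)%N)
  end.

Definition fps_inv (f : fps) : fps := fun n => nth 0 (finv_seq f n) n.

Definition qpoch (x : rat) (k : nat) : rat := \prod_(1 <= j < k.+1) (1 - x ^+ j).

(* sum_{k>=0} u^{k d} / (q^{k^2 d + e k} (1/q^d)_k), for d >= 1,
   as a coefficient sequence *)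
Definition gser (q d e : nat) : fps :=
  fun n => if (d %| n)%N then
             let k := (n %/ d)%N in
             ((q%:R : rat) ^+ (k * k * d + e * k)%N * qpoch ((q%:R : rat) ^+ d)^-1 k)^-1
           else 0.

Definition fps_lim (P : nat -> fps) (f : fps) : Prop :=
  forall n, exists M, forall m, (M <= m)%N -> P m n = f n.

(* Main.v *)
Require Import Defs.
From HB Require Import structures.
From mathcomp Require Import all_boot all_order all_algebra all_field.
From mathcomp Require Import fingroup cyclic finalg mxred mxabelem qfpoly boolp.

Set Implicit Arguments.
Unset Strict Implicit.
Unset Printing Implicit Defensive.

Import GRing.Theory Num.Theory.
Local Open Scope ring_scope.

(** The semisimple elements of GL(n,q) with n <= m are the matrices killed by
    the product P of the monic irreducible polynomials of degree at most m other
    than X: squarefree and separable coincide over a finite field.  Let G_f be the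
    series with coefficients #{x in M_n : f(x) = 0} / |GL(n,q)|.

    - If f and g are coprime then G_(fg) = G_f G_g: the map sending (h, y, z) to
      h^-1 diag(y, z) h, where f(y) = g(z) = 0, has all its nonempty fibers of size
      |GL(k,q)| |GL(l,q)|, because an intertwiner between coprime parts vanishes.
    - If f is irreducible of degree d, then G_f counts matrices making F_q^n a
      vector space over F_q[X]/(f).  Each h in GL(kd,q) conjugates the k-fold block
      companion matrix C of f to one such x, and the h with C h = h x are the
      ordered bases of that space, (q^n - 1)(q^n - q^d) ... (q^n - q^((k-1)d)) of them.
    - An element [1 b; 0 y] of A(n,q) is semisimple iff y is semisimple and b lies
      in the row space of y - 1.  This weights y by q^(rank(y - 1) - n) = q^(-k) with
      k the multiplicity of the eigenvalue 1, and only alters the factor of X - 1. *)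

Lemma irredp_coprime (F : fieldType) (P Q : {poly F}) :
  irreducible_poly P -> ~~ (P %| Q) -> coprimep P Q.
Proof.
move=> Pirr; apply: contraR => ncPQ.
have /eqp_dvdl <- : gcdp P Q %= P by apply: Pirr; rewrite ?dvdp_gcdl.
exact: dvdp_gcdr.
Qed.

(** * Polynomials evaluated at square matrices, and intertwiners *)

Section PolyEval.

Variable F : fieldType.
Implicit Types P Q : {poly F}.

(* Unlike [horner_mx], defined for matrices of dimension 0 as well. *)
Definition peval n (P : {poly F}) (x : 'M[F]_n) : 'M[F]_n :=
  \sum_(i < size P) P`_i *: x ^+ i.

Lemma pevalE n P (x : 'M[F]_n.+1) : peval P x = horner_mx x P.
Proof.
rewrite -[in RHS](coefK P) poly_def rmorph_sum /=.
apply: eq_bigr => i _; by rewrite horner_mxZ rmorphXn /= horner_mx_X.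
Qed.

Lemma pevalM n P Q (x : 'M[F]_n) : peval (P * Q) x = peval P x *m peval Q x.
Proof. by case: n x => [|n] x; rewrite ?[RHS]thinmx0 ?thinmx0 // !pevalE rmorphM. Qed.

Lemma pevalD n P Q (x : 'M[F]_n) : peval (P + Q) x = peval P x + peval Q x.
Proof. by case: n x => [|n] x; rewrite ?[RHS]thinmx0 ?thinmx0 // !pevalE rmorphD. Qed.

Lemma peval1 n (x : 'M[F]_n) : peval 1 x = 1%:M.
Proof. by case: n x => [|n] x; rewrite ?[RHS]thinmx0 ?thinmx0 // pevalE rmorph1. Qed.

Lemma peval_XsubC n a (x : 'M[F]_n) : peval ('X - a%:P) x = x - a%:M.
Proof.
case: n x => [|n] x; rewrite ?[RHS]thinmx0 ?thinmx0 //.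
by rewrite pevalE rmorphB /= horner_mx_X horner_mx_C.
Qed.

Lemma pevalC n P Q (x : 'M[F]_n) :
  peval P x *m peval Q x = peval Q x *m peval P x.
Proof. by rewrite -!pevalM mulrC. Qed.

Lemma exp_intertwine m n (x : 'M[F]_m) (y : 'M[F]_n) (h : 'M[F]_(m, n)) i :
  x *m h = h *m y -> x ^+ i *m h = h *m y ^+ i.
Proof.
move=> xh; elim: i => [|i IH]; first by rewrite mul1mx mulmx1.
rewrite !exprSr -[x ^+ i * x]/(_ *m _) -[y ^+ i * _]/(_ *m _).
by rewrite -mulmxA xh !mulmxA IH.
Qed.

(** The matrix [h] may be rectangular, so that conjugation, inclusion of a diagonal block and
    restriction to a stable row space are all instances. *)
Lemma peval_intertwine m n P (x : 'M[F]_m) (y : 'M[F]_n) (h : 'M[F]_(m, n)) :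
  x *m h = h *m y -> peval P x *m h = h *m peval P y.
Proof.
move=> xh; rewrite /peval mulmx_suml mulmx_sumr; apply: eq_bigr => i _.
by rewrite -scalemxAl -scalemxAr (exp_intertwine i xh).
Qed.

Lemma peval_conj n P (x g : 'M[F]_n) : g \in unitmx ->
  peval P (invmx g *m x *m g) = invmx g *m peval P x *m g.
Proof.
move=> gU; have /(peval_intertwine P) e : x *m g = g *m (invmx g *m x *m g).
  by rewrite !mulmxA mulmxV // mul1mx.
by rewrite -[RHS]mulmxA e mulKmx.
Qed.

(** The two block columns of the identity intertwine diag(y, z) with y and with z, so each block
    column of the value is read off separately. *)
Lemma peval_diag k l P (y : 'M[F]_k) (z : 'M[F]_l) :
  peval P (block_mx y 0 0 z) = block_mx (peval P y) 0 0 (peval P z).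
Proof.
have e1 : block_mx y 0 0 z *m col_mx 1%:M 0 = col_mx 1%:M 0 *m y.
  by rewrite mul_block_col mul_col_mx !(mulmx0, mul0mx, mulmx1, mul1mx, addr0).
have e2 : block_mx y 0 0 z *m col_mx 0 1%:M = col_mx 0 1%:M *m z.
  by rewrite mul_block_col mul_col_mx !(mulmx0, mul0mx, mulmx1, mul1mx, add0r).
rewrite -[LHS]mulmx1 (scalar_mx_block k l 1) [X in _ *m X]block_mxEh mul_mx_row.
rewrite (peval_intertwine P e1) (peval_intertwine P e2) !mul_col_mx.
by rewrite !(mul0mx, mul1mx) -block_mxEh.
Qed.

(** These are Bezout coefficients; a single pair serves all dimensions and all matrices. *)
Lemma coprimep_peval P Q : coprimep P Q -> exists U V : {poly F},
  forall n (x : 'M[F]_n), peval U x *m peval P x + peval V x *m peval Q x = 1%:M.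
Proof.
case/Bezout_eq1_coprimepP=> [[U V] /= UV]; exists U, V => n x.
by rewrite -!pevalM -pevalD UV peval1.
Qed.

Lemma peval_coprime_unit n P Q (x : 'M[F]_n) :
  coprimep P Q -> peval P x = 0 -> peval Q x \in unitmx.
Proof.
case/coprimep_peval=> [U [V UV]] Px0.
by have := UV n x; rewrite Px0 mulmx0 add0r => /mulmx1_unit[].
Qed.

(** Q(x) is invertible because P kills x, while Q(x) h = h Q(y) = 0. *)
Lemma intertwine_coprime_eq0 m n P Q (x : 'M[F]_m) (y : 'M[F]_n) h :
  coprimep P Q -> peval P x = 0 -> peval Q y = 0 -> x *m h = h *m y -> h = 0.
Proof.
move=> cPQ Px0 Qy0 xh; have Qu := peval_coprime_unit cPQ Px0.
by rewrite -(mulKmx Qu h) (peval_intertwine Q xh) Qy0 !mulmx0.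
Qed.

End PolyEval.

(** * Primary decomposition for two coprime factors, as a weighted count *)

Section CoprimeSplitting.

Variable F : finFieldType.
Implicit Types P Q : {poly F}.

Definition annih n P : {set 'M[F]_n} := [set x | peval P x == 0].

Lemma annihP n P (x : 'M[F]_n) : reflect (peval P x = 0) (x \in annih n P).
Proof. by rewrite inE; apply: eqP. Qed.

(** Fiber over x of the map (g, y, z) -> g^-1 diag(y, z) g, with the equation written free of
    inverses. *)
Definition split_fiber k l P Q (x : 'M[F]_(k + l)) :
    {set 'M[F]_(k + l) * ('M[F]_k * 'M[F]_l)} :=
  [set t | [&& t.1 \in unitmx, t.2.1 \in annih k P, t.2.2 \in annih l Q &
               block_mx t.2.1 0 0 t.2.2 *m t.1 == t.1 *m x]].

Lemma split_fiberP k l P Q (x : 'M[F]_(k + l)) g y z :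
  reflect [/\ g \in unitmx, peval P y = 0, peval Q z = 0 &
              block_mx y 0 0 z *m g = g *m x]
          ((g, (y, z)) \in split_fiber P Q x).
Proof.
rewrite inE /=; apply: (iffP and4P) => [[? /annihP ? /annihP ? /eqP ?] //|].
by case=> *; split=> //; [apply/annihP | apply/annihP | apply/eqP].
Qed.

(** Q kills z and is invertible at y, so the rank of Q(x) recovers the size k of the block killed by
    P. *)
Lemma split_fiber_annih k l P Q (x : 'M[F]_(k + l)) g y z : coprimep P Q ->
  (g, (y, z)) \in split_fiber P Q x ->
  peval (P * Q) x = 0 /\ \rank (peval Q x) = k.
Proof.
move=> cPQ /split_fiberP[gU Py Qz e].
have eR R : peval R x = invmx g *m block_mx (peval R y) 0 0 (peval R z) *m g.
  by rewrite -peval_diag -mulmxA (peval_intertwine R e) mulKmx.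
split.
  by rewrite eR !pevalM Py Qz mul0mx mulmx0 block_mx0 mulmx0 mul0mx.
rewrite eR mxrankMfree ?row_free_unit // eqmxMfull ?row_full_unit ?unitmx_inv //.
rewrite Qz rank_diag_block_mx mxrank0 addn0 mxrank_unit //.
exact: peval_coprime_unit cPQ Py.
Qed.

Lemma exists_row_base m n k (A : 'M[F]_(m, n)) :
  \rank A = k -> exists2 u : 'M[F]_(k, n), (u :=: A)%MS & row_free u.
Proof.
move=> <-; exists (row_base A); first exact: eq_row_base.
exact: row_base_free.
Qed.

(** The row spaces of Q(x) and P(x) are complementary, stable under x, and killed by P and Q
    respectively. Stacking bases of the two gives g. *)
Lemma split_fiber_exists k l P Q (x : 'M[F]_(k + l)) : coprimep P Q ->
  peval (P * Q) x = 0 -> \rank (peval Q x) = k ->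
  exists g y z, (g, (y, z)) \in split_fiber P Q x.
Proof.
move=> cPQ PQ0 rQ; have [U [V UV]] := coprimep_peval cPQ.
have PQx : peval P x *m peval Q x = 0 by rewrite -pevalM.
have QPx : peval Q x *m peval P x = 0 by rewrite pevalC.
have full : (1%:M <= peval Q x + peval P x)%MS.
  by rewrite -(UV _ x) addrC addmx_sub_adds // submxMl.
(* The ranks of P(x) and Q(x) add up to at least k + l by the Bezout identity, and to at most k + l
   because P(x) Q(x) = 0. *)
have rP : \rank (peval P x) = l.
  have := mulmx0_rank_max PQx; have := mxrankS full; rewrite mxrank1 => h1 h2.
  have h3 := leq_trans h1 (mxrank_adds_leqif _ _); rewrite rQ in h2 h3.
  by apply/eqP; rewrite -(eqn_add2l k) eqn_leq h3 addnC h2.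
have [u uQ uf] := exists_row_base rQ; have [v vP vf] := exists_row_base rP.
(* The matrix x is the value of the polynomial X at x, hence commutes with R(x) and preserves its
   row space. *)
have stab m R (w : 'M[F]_(m, k + l)) : (w :=: peval R x)%MS ->
    exists y, w *m x = y *m w.
  move=> wR; apply/submxP; rewrite (eqmxMr x wR) wR.
  have eX : peval 'X x = x by rewrite -['X]subr0 -polyC0 peval_XsubC raddf0 subr0.
  by rewrite -[X in (_ *m X <= _)%MS]eX pevalC submxMl.
have [y ey] := stab _ _ _ uQ; have [z ez] := stab _ _ _ vP.
exists (col_mx u v), y, z; apply/split_fiberP; split.
- rewrite -row_full_unit -sub1mx (submx_trans full) // -addsmxE.
  by rewrite (adds_eqmx uQ vP).
- apply: (row_free_inj uf); rewrite mul0mx (peval_intertwine P (esym ey)).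
  by have /submxP[s ->] : (u <= peval Q x)%MS; rewrite ?uQ // -mulmxA QPx mulmx0.
- apply: (row_free_inj vf); rewrite mul0mx (peval_intertwine Q (esym ez)).
  by have /submxP[s ->] : (v <= peval P x)%MS; rewrite ?vP // -mulmxA PQx mulmx0.
- by rewrite mul_block_col mul_col_mx !mul0mx addr0 add0r ey ez.
Qed.

(** GL(k) x GL(l) acts simply transitively on a nonempty fiber. Two points of it differ by h = g
    g0^-1, which intertwines the two block diagonal matrices; its off-diagonal blocks intertwine
    coprime parts and vanish. *)
Lemma card_split_fiber k l P Q (x : 'M[F]_(k + l)) g0 y0 z0 : coprimep P Q ->
  (g0, (y0, z0)) \in split_fiber P Q x ->
  #|split_fiber P Q x| = (#|GLset F k| * #|GLset F l|)%N.
Proof.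
move=> cPQ /split_fiberP[g0U Py0 Qz0 e0]; rewrite -cardsX.
pose f (t : 'M[F]_k * 'M[F]_l) := (block_mx t.1 0 0 t.2 *m g0,
  (t.1 *m y0 *m invmx t.1, t.2 *m z0 *m invmx t.2)).
rewrite -(@card_in_imset _ _ f); last first.
  move=> [a b] [a' b'] _ _ [/(congr1 (mulmx^~ (invmx g0))) /=].
  by rewrite !mulmxK // => /eq_block_mx[-> _ _ ->].
have conj0 n R (a y : 'M[F]_n) : a \in unitmx ->
    (peval R (a *m y *m invmx a) == 0) = (peval R y == 0).
  move=> aU; rewrite -{1}(invmxK a) peval_conj ?unitmx_inv // invmxK.
  apply/eqP/eqP => [|->]; last by rewrite mulmx0 mul0mx.
  move=> /(congr1 (fun t => invmx a *m (t *m a))).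
  by rewrite mulmxKV // mulKmx // mul0mx mulmx0.
congr #|pred_of_set _|; apply/eqP; rewrite eqEsubset.
apply/andP; split; apply/subsetP.
  move=> [g [y z]] /split_fiberP[gU Py Qz e].
  pose h := g *m invmx g0.
  have hU : h \in unitmx by rewrite unitmx_mul gU unitmx_inv.
  have he : block_mx y 0 0 z *m h = h *m block_mx y0 0 0 z0.
    rewrite /h mulmxA e -[RHS]mulmx1 -(mulmxV g0U) -!mulmxA; congr (_ *m _).
    rewrite (mulmxA _ g0) e0 (mulmxA (invmx _)) -(mulmxA (invmx _)) !mulmxA.
    by rewrite mulVmx // mul1mx.
  move: hU he; rewrite -(submxK h); set a := ulsubmx h; set b := drsubmx h.
  rewrite !mulmx_block !(mul0mx, mulmx0, add0r, addr0) => hU /eq_block_mx[ea e1 e2 eb].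
  have h1 : ursubmx h = 0 by apply: intertwine_coprime_eq0 cPQ Py Qz0 e1.
  have h2 : dlsubmx h = 0.
    by apply: intertwine_coprime_eq0 Qz Py0 e2; rewrite coprimep_sym.
  move: hU; rewrite h1 h2 block_diag_mx_unit => /andP[aU bU].
  apply/imsetP; exists (a, b); first by rewrite !inE aU bU.
  rewrite /f /= -ea -eb !mulmxK //; congr (_, _).
  by rewrite -{1}h1 -h2 submxK mulmxKV.
move=> t /imsetP[[a b] /setXP[aU bU] ->]; rewrite !inE in aU bU.
rewrite /f /=; apply/split_fiberP; split=> /=.
- by rewrite unitmx_mul block_diag_mx_unit aU bU.
- by apply/eqP; rewrite conj0 // Py0.
- by apply/eqP; rewrite conj0 // Qz0.
- rewrite -[RHS]mulmxA -e0 !mulmxA; congr (_ *m _).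
  by rewrite !mulmx_block !(mul0mx, mulmx0, add0r, addr0) !mulmxKV.
Qed.

(** Double count of the pairs of a matrix x and a triple in its fiber: each triple determines x, and
    each x of the given rank has a fiber of constant size. The invariant weight [w] is 1 for GL and
    depends on the rank of y - 1 for the affine group. *)
Lemma sum_split_rank (w : forall n, 'M[F]_n -> rat) k l P Q : coprimep P Q ->
  (forall n (x g : 'M[F]_n), g \in unitmx -> w n (invmx g *m x *m g) = w n x) ->
  (\sum_(x in annih (k + l) (P * Q) | \rank (peval Q x) == k) w _ x)
    / #|GLset F (k + l)|%:R
  = (\sum_(y in annih k P) \sum_(z in annih l Q) w _ (block_mx y 0 0 z))
    / (#|GLset F k|%:R * #|GLset F l|%:R).
Proof.
move=> cPQ wJ.
have GL0 n : #|GLset F n|%:R != 0 :> rat.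
  rewrite pnatr_eq0 -lt0n; apply/card_gt0P; exists 1%:M.
  by rewrite inE unitmx1.
apply/eqP; rewrite eqr_div ?mulf_neq0 //; apply/eqP.
transitivity (\sum_(x : 'M[F]_(k + l)) \sum_(t in split_fiber P Q x) w _ x).
  rewrite big_distrl /= big_mkcond; apply: eq_bigr => x _.
  rewrite sumr_const -[RHS]mulr_natr.
  have [f0 | [[g [y z]] gyz]] := set_0Vmem (split_fiber P Q x).
    rewrite f0 cards0 mulr0; case: ifP => // /andP[/annihP PQ0 /eqP rQ].
    by have [g [y [z]]] := split_fiber_exists cPQ PQ0 rQ; rewrite f0 inE.
  have [/annihP -> ->] := split_fiber_annih cPQ gyz.
  by rewrite eqxx /= (card_split_fiber cPQ gyz) natrM.
rewrite (exchange_big_dep predT) //= mulr_natr -sumr_const.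
under [RHS]eq_bigr do rewrite pair_big /=.
rewrite pair_big /= [RHS]big_mkcond; apply: eq_bigr => [[g [y z]] _] /=.
case: ifP => [/and3P[]|cF].
  rewrite inE => gU /annihP yP /annihP zQ.
  rewrite (big_pred1 (invmx g *m block_mx y 0 0 z *m g)) ?wJ // => x.
  apply/split_fiberP/eqP => [[_ _ _ e]|->].
    by rewrite -mulmxA e mulKmx.
  by split=> //; rewrite -!mulmxA mulKVmx.
apply: big_pred0 => x; apply/negP => /split_fiberP[gU yP zQ _].
by move/negP: cF; rewrite inE gU !inE yP zQ !eqxx.
Qed.

End CoprimeSplitting.

(** * Formal power series: ring laws and inverses *)

Section FormalPowerSeries.

Implicit Types f g h : fps.

(** Coefficient n sees only the truncations of the factors, so commutativity and associativity are
    inherited from [{poly rat}]. *)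
Lemma fmul_coef f g N n : (n < N)%N ->
  fmul f g n = (\poly_(i < N) f i * \poly_(i < N) g i)`_n.
Proof.
move=> ltnN; rewrite coefM; apply: eq_bigr => i _; rewrite !coef_poly.
have -> : (i < N)%N by apply: leq_trans ltnN; apply: leq_ord.
by rewrite (leq_ltn_trans (leq_subr _ _) ltnN).
Qed.

Lemma fmulC : commutative fmul.
Proof. by move=> f g; apply: funext => n; rewrite !(@fmul_coef _ _ n.+1) // mulrC. Qed.

Lemma fmul_poly f (p : {poly rat}) n :
  fmul f (fun i => p`_i) n = (\poly_(i < n.+1) f i * p)`_n.
Proof.
by rewrite coefM; apply: eq_bigr => i _; rewrite coef_poly ltn_ord.
Qed.

Lemma eq_fmul f f' g g' n : (forall i, (i <= n)%N -> f i = f' i) ->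
  (forall i, (i <= n)%N -> g i = g' i) -> fmul f g n = fmul f' g' n.
Proof.
move=> ff' gg'; apply: eq_bigr => i _.
by rewrite ff' ?gg' // ?leq_subr // leq_ord.
Qed.

Lemma fmulA : associative fmul.
Proof.
move=> f g h; apply: funext => n; pose p f := \poly_(i < n.+1) f i : {poly rat}.
rewrite (@eq_fmul f f _ (fun i => (p g * p h)`_i)) // => [|i lein]; last first.
  by rewrite (@fmul_coef _ _ n.+1).
rewrite [RHS](@eq_fmul _ (fun i => (p f * p g)`_i) h h) // => [|i lein]; last first.
  by rewrite (@fmul_coef _ _ n.+1).
by rewrite (fmulC _ h) !fmul_poly mulrA (mulrC (p f * p g)).
Qed.

Lemma fmul1f : left_id fone fmul.
Proof.
move=> f; apply: funext => n; rewrite /fmul big_ord_recl big1 ?addr0 => [|i _].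
  by rewrite /fone eqxx mul1r subn0.
by rewrite /fone mul0r.
Qed.

HB.instance Definition _ := Monoid.isComLaw.Build fps fone fmul fmulA fmulC fmul1f.

Lemma size_finv_seq f n : size (finv_seq f n) = n.+1.
Proof. by elim: n => //= n IH; rewrite size_rcons IH. Qed.

(** Each sequence [finv_seq f n] is a prefix of the next one, so its entries do not depend on n. *)
Lemma nth_finv_seq f n i : (i <= n)%N -> nth 0 (finv_seq f n) i = fps_inv f i.
Proof.
elim: n => [|n IH]; first by rewrite leqn0 => /eqP ->.
rewrite leq_eqVlt => /predU1P[-> //|lein].
by rewrite /= nth_rcons size_finv_seq lein IH.
Qed.

Lemma fmul_inv f : f 0%N != 0 -> fmul f (fps_inv f) = fone.
Proof.
move=> f0; apply: funext => -[|n].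
  by rewrite /fmul big_ord_recl big_ord0 addr0 /= mulfV.
rewrite /fmul big_ord_recl /= subn0 {1}/fps_inv /= nth_rcons size_finv_seq.
rewrite ltnn eqxx mulNr mulrN mulVKf // addrC; apply/eqP; rewrite subr_eq0.
apply/eqP/eq_bigr => i _; rewrite /bump /= add1n subSS.
by rewrite nth_finv_seq ?leq_subr.
Qed.

End FormalPowerSeries.

(** * The counting series of annihilated matrices is multiplicative *)

Section CountingSeries.

Variable F : finFieldType.
Implicit Types P Q : {poly F}.

Definition annih_fps P : fps := fun n => #|annih n P|%:R / #|GLset F n|%:R.

(** Sorting the matrices x by the rank k of Q(x) turns the sum into a convolution over k. *)
Lemma sum_annih_split (w : forall n, 'M[F]_n -> rat) n P Q : coprimep P Q ->
  (forall n (x g : 'M[F]_n), g \in unitmx -> w n (invmx g *m x *m g) = w n x) ->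
  (\sum_(x in annih n (P * Q)) w _ x) / #|GLset F n|%:R =
  \sum_(k < n.+1)
    (\sum_(y in annih k P) \sum_(z in annih (n - k) Q) w _ (block_mx y 0 0 z))
      / (#|GLset F k|%:R * #|GLset F (n - k)|%:R).
Proof.
move=> cPQ wJ.
rewrite (partition_big (fun x => inord (\rank (peval Q x)) : 'I_n.+1) predT) //=.
rewrite mulr_suml; apply: eq_bigr => k _; rewrite -sum_split_rank //.
(* The dimensions [k + (n - k)] and [n] give different matrix types; a variable dimension m allows
   the passage from one to the other. *)
have rkE m : m = n -> 
  (\sum_(x in annih m (P * Q) | \rank (peval Q x) == k) w m x) / #|GLset F m|%:R
  = (\sum_(x in annih n (P * Q) | \rank (peval Q x) == k) w n x) / #|GLset F n|%:R.
  by move=> ->.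
rewrite rkE ?subnKC ?leq_ord //; congr (_ / _); apply: eq_bigl => x.
by rewrite -val_eqE /= inordK // ltnS rank_leq_row.
Qed.

Lemma annih_fpsM P Q : coprimep P Q ->
  annih_fps (P * Q) = fmul (annih_fps P) (annih_fps Q).
Proof.
move=> cPQ; apply: funext => n; rewrite /annih_fps -sumr_const.
rewrite (@sum_annih_split (fun _ _ => 1)) //; apply: eq_bigr => k _.
by rewrite !sumr_const -mulrnA mulnC natrM mulf_div.
Qed.

Lemma annih_fps1 : annih_fps 1 = fone.
Proof.
apply: funext => -[|n]; rewrite /annih_fps /fone.
  have -> : annih 0 1 = GLset F 0.
    by apply/setP => x; rewrite !inE [peval _ _]thinmx0 unitmxE det_mx00 unitr1 eqxx.
  rewrite divff // pnatr_eq0 -lt0n; apply/card_gt0P; exists 1%:M.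
  by rewrite inE unitmx1.
rewrite (_ : annih _ _ = set0) ?cards0 ?mul0r //.
by apply/setP => x; rewrite !inE peval1 oner_eq0.
Qed.

End CountingSeries.

(** * Matrices killed by one irreducible polynomial *)

Section IrreducibleCount.

Variables (F : finFieldType) (d' : nat) (P : {poly F}).
Hypotheses (Pmon : P \is monic) (sizeP : size P = d'.+2).
Local Notation d := d'.+1.

(** Companion matrix acting on rows: multiplication by X on F[X]/(P) in the basis 1, X, ...,
    X^(d-1). *)
Definition compan : 'M[F]_d :=
  \matrix_(i, j) if i == ord_max then - P`_j else (j == i.+1 :> nat)%:R.

(** Krylov matrix of w. When P(x) = 0 it represents the F[X]-linear map from F[X]/(P) to row vectors
    that sends 1 to w. *)
Definition cyc n (x : 'M[F]_n) (w : 'rV[F]_n) : 'M[F]_(d, n) :=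
  \matrix_(i < d) (w *m x ^+ i).

Lemma expmxSr n (x : 'M[F]_n) i : x ^+ i.+1 = x ^+ i *m x.
Proof. exact: exprSr. Qed.

Lemma delta_compan i (i' : 'I_d) : i.+1 = i' ->
  delta_mx 0 (inord i) *m compan = delta_mx (0 : 'I_1) i'.
Proof.
move=> ii'; have lti : (i < d')%N by rewrite -ltnS ii' ltn_ord.
apply/rowP => j; rewrite -rowE !mxE -val_eqE /= inordK ?(ltn_trans lti) //.
by rewrite ltn_eqF // ii'.
Qed.

Lemma delta_exp_compan (i : 'I_d) :
  delta_mx (0 : 'I_1) ord0 *m compan ^+ i = delta_mx 0 i.
Proof.
suff H k : (k < d)%N ->
    delta_mx (0 : 'I_1) ord0 *m compan ^+ k = delta_mx 0 (inord k).
  by rewrite H // inord_val.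
elim: k => [|k IH] ltk.
  by rewrite mulmx1; congr (delta_mx _ _); apply: val_inj; rewrite /= inordK.
by rewrite expmxSr mulmxA IH ?(ltnW ltk) // (@delta_compan k (inord k.+1)) ?inordK.
Qed.

Lemma peval_wide n N (Q : {poly F}) (x : 'M[F]_n) : (size Q <= N)%N ->
  peval Q x = \sum_(i < N) Q`_i *: x ^+ i.
Proof.
move=> leN; rewrite /peval (big_ord_widen N (fun i => Q`_i *: x ^+ i)) //.
rewrite big_mkcond; apply: eq_bigr => i _.
by case: ltnP => // /(nth_default 0) ->; rewrite scale0r.
Qed.

Lemma peval_monic n (x : 'M[F]_n) :
  peval P x = \sum_(i < d) P`_i *: x ^+ i + x ^+ d.
Proof.
rewrite (@peval_wide _ d'.+2) ?sizeP // big_ord_recr /=.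
have -> : P`_d = 1 by move/monicP: Pmon; rewrite /lead_coef sizeP.
by rewrite scale1r.
Qed.

Lemma peval_rVpoly n (x : 'M[F]_n) (u : 'rV[F]_d) w :
  w *m peval (rVpoly u) x = u *m cyc x w.
Proof.
rewrite (@peval_wide _ d) ?size_poly // [RHS]mulmx_sum_row mulmx_sumr.
by apply: eq_bigr => i _; rewrite rowK coef_rVpoly_ord scalemxAr.
Qed.

Lemma cyc_compan (u : 'rV[F]_d) :
  delta_mx 0 ord0 *m peval (rVpoly u) compan = u.
Proof.
rewrite peval_rVpoly [RHS]row_sum_delta mulmx_sum_row.
by apply: eq_bigr => i _; rewrite rowK delta_exp_compan.
Qed.

Lemma compan_max (i : 'I_d) : i = ord_max ->
  row i compan = - \row_j P`_j.
Proof. by move=> ->; apply/rowP => j; rewrite !mxE eqxx. Qed.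

(** All rows but the last are shifts by definition; the last one is the relation w P(x) = 0. *)
Lemma compan_cyc n (x : 'M[F]_n) w : peval P x = 0 ->
  compan *m cyc x w = cyc x w *m x.
Proof.
move=> Px; apply/row_matrixP => i; rewrite !row_mul rowK -mulmxA -expmxSr.
have [im | ni] := eqVneq i ord_max; last first.
  have lti : (i.+1 < d)%N.
    rewrite ltnS ltn_neqAle -ltnS ltn_ord andbT.
    by apply: contra ni => /eqP e; apply/eqP/val_inj.
  rewrite rowE -[X in delta_mx 0 X](inord_val i) (@delta_compan i (Ordinal lti)) //.
  by rewrite -rowE rowK.
rewrite compan_max // im mulNmx mulmx_sum_row; apply/esym/eqP.
rewrite -addr_eq0 addrC; apply/eqP.
transitivity (w *m peval P x); last by rewrite Px mulmx0.
rewrite peval_monic mulmxDr mulmx_sumr; congr (_ + _); apply: eq_bigr => j _.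
by rewrite mxE rowK scalemxAr.
Qed.

(** Vanishing on the first basis row suffices: that row is cyclic, and P(C) commutes with the powers
    of C. *)
Lemma peval_compan : peval P compan = 0.
Proof.
suff e0 : delta_mx (0 : 'I_1) ord0 *m peval P compan = 0.
  apply/row_matrixP => i; rewrite rowE row0 -delta_exp_compan -mulmxA.
  have /(peval_intertwine P) <- : compan *m compan ^+ i = compan ^+ i *m compan.
    by rewrite -expmxSr exprS.
  by rewrite mulmxA e0 mul0mx.
rewrite peval_monic mulmxDr expmxSr mulmxA mulmx_sumr.
have -> : compan ^+ d' = compan ^+ (ord_max : 'I_d) by [].
rewrite delta_exp_compan -rowE compan_max //; apply/eqP; rewrite subr_eq0.
rewrite [X in _ == X]row_sum_delta; apply/eqP/eq_bigr => i _.
by rewrite -scalemxAr delta_exp_compan mxE.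
Qed.

Lemma intertwine_cyc n (x : 'M[F]_n) (g : 'M[F]_(d, n)) :
  compan *m g = g *m x -> g = cyc x (row 0 g).
Proof.
move=> cg; apply/row_matrixP => i.
rewrite rowK rowE -delta_exp_compan -mulmxA (exp_intertwine i cg) mulmxA.
by rewrite -rowE.
Qed.

(** The type annotations rely on [s.+1 * d] being convertible to [d + s * d]. *)
Fixpoint block_compan r : 'M[F]_(r * d) :=
  if r is s.+1 return 'M[F]_(r * d) then
    (block_mx compan 0 0 (block_compan s) : 'M[F]_(d + s * d)) else 0.

Lemma peval_block_compan r : peval P (block_compan r) = 0.
Proof.
elim: r => [|r IH]; first exact: thinmx0.
by rewrite /= (@peval_diag _ d (r * d)) IH peval_compan block_mx0.
Qed.

Hypothesis Pirr : irreducible_poly P.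

(** The row space of g is stable under x, hence a subspace over the field F[X]/(P). Adjoining the
    line of w over that field keeps the rows independent exactly when w lies outside. *)
Lemma cyc_row_free n m (x : 'M[F]_n) w (g : 'M[F]_(m, n)) (c : 'M[F]_m) :
  peval P x = 0 -> c *m g = g *m x ->
  row_free (col_mx (cyc x w) g) = row_free g && ~~ (w <= g)%MS.
Proof.
move=> Px cg.
have wE : w = delta_mx 0 ord0 *m cyc x w by rewrite -rowE rowK mulmx1.
apply/idP/andP => [/row_freeP[h]|[gf wg]].
  rewrite mul_col_mx scalar_mx_block => eh; split.
    apply/row_freeP; exists (rsubmx h).
    move: eh; rewrite -[h]hsubmxK !mul_mx_row => /eq_block_mx[_ _ _].
    by rewrite row_mxKr.
  apply/negP => /submxP[s ws].
  move: eh; rewrite -[h]hsubmxK !mul_mx_row => /eq_block_mx[e1 _ e2 _].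
  have : w *m lsubmx h = delta_mx 0 ord0 by rewrite wE -mulmxA e1 mulmx1.
  rewrite ws -mulmxA e2 mulmx0 => /matrixP/(_ 0 ord0); rewrite !mxE !eqxx /= => /eqP.
  by rewrite eq_sym oner_eq0.
apply/inj_row_free => u; rewrite -[u]hsubmxK mul_row_col.
set u1 := lsubmx u; set u2 := rsubmx u => e.
suff u10 : u1 = 0.
  rewrite u10 mul0mx add0r in e *.
  have -> : u2 = 0 by apply: (row_free_inj gf); rewrite e mul0mx.
  by rewrite row_mx0.
apply/eqP; apply: contraNT wg => u1N.
(* A nonzero u1 is a polynomial of degree less than d, hence invertible modulo P. Applying its
   inverse U to the relation [e] solves for w inside the row space of g. *)
have cPu : coprimep (rVpoly u1) P.
  rewrite coprimep_sym irredp_coprime //.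
  apply: contraNN u1N => /(dvdp_leq _); rewrite sizeP => H.
  rewrite -(rVpolyK u1); apply/eqP.
  have [-> | ] := eqVneq (rVpoly u1) 0; first by rewrite linear0.
  by move/H => /leq_trans/(_ (size_poly _ _)); rewrite ltnn.
have [U [V UV]] := coprimep_peval cPu.
have e0 : delta_mx (0 : 'I_1) ord0 = u1 *m peval U compan.
  rewrite -[LHS]mulmx1 -(UV _ compan) peval_compan mulmx0 addr0.
  by rewrite pevalC mulmxA cyc_compan.
rewrite wE e0 -mulmxA (peval_intertwine U (compan_cyc w Px)) mulmxA.
have -> : u1 *m cyc x w = - (u2 *m g) by apply/eqP; rewrite -addr_eq0 e.
by rewrite mulNmx -mulmxA -(peval_intertwine U cg) mulmxA -mulNmx submxMl.
Qed.

(** When P(x) = 0, these encode the r-tuples of vectors independent over F[X]/(P), each block of d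
    rows being the Krylov matrix of one vector. *)
Definition intertwiners n r (x : 'M[F]_n) : {set 'M[F]_(r * d, n)} :=
  [set g | row_free g && (block_compan r *m g == g *m x)].

Lemma card_notin_rowspace n m (g : 'M[F]_(m, n)) : row_free g ->
  #|[set w : 'rV[F]_n | ~~ (w <= g)%MS]| = (#|F| ^ n - #|F| ^ m)%N.
Proof.
move=> /eqP gf; rewrite cardsCs (_ : ~: _ = rowg g).
  by rewrite card_rowg gf card_mx mul1n.
by apply/setP => w; rewrite !inE negbK.
Qed.

(** The vectors are chosen one after the other; the one with index i must avoid the span of its
    predecessors, which has q^(i d) elements. *)
Lemma card_intertwiners n r (x : 'M[F]_n) : peval P x = 0 ->
  #|intertwiners r x| = (\prod_(i < r) (#|F| ^ n - #|F| ^ (i * d)))%N.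
Proof.
move=> Px; elim: r => [|r IH].
  rewrite big_ord0; apply/eqP/cards1P; exists 0; apply/setP => g.
  rewrite !inE [g]flatmx0 mulmx0 mul0mx !eqxx andbT.
  by rewrite /row_free -leqn0 rank_leq_row.
rewrite big_ord_recr /= -IH.
pose f (t : 'M[F]_(r * d, n) * 'rV[F]_n) : 'M[F]_(r.+1 * d, n) :=
  col_mx (cyc x t.2) t.1.
pose S := [set t : 'M[F]_(r * d, n) * 'rV[F]_n |
            (t.1 \in intertwiners r x) && ~~ (t.2 <= t.1)%MS].
have -> : intertwiners r.+1 x = f @: S.
  apply/setP => g; apply/idP/imsetP => [|[[g2 w]]].
    rewrite inE -[g](@vsubmxK _ d (r * d)) /=.
    set g1 := usubmx _; set g2 := dsubmx _.
    rewrite (@mul_block_col _ d (r * d) d (r * d)) (@mul_col_mx _ d (r * d)).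
    rewrite !mul0mx addr0 add0r => /andP[gf /eqP/(@eq_col_mx _ d)[e1 e2]].
    exists (g2, row 0 g1); last by rewrite /f /= -intertwine_cyc.
    move: gf; rewrite (intertwine_cyc e1) (cyc_row_free _ Px e2) => /andP[gf wg].
    rewrite !inE /= gf e2 eqxx /=.
    by move: wg; rewrite -intertwine_cyc.
  rewrite !inE /= => /andP[/andP[gf /eqP e2] wg] ->.
  rewrite /f /= (cyc_row_free _ Px e2) gf wg /=.
  rewrite (@mul_block_col _ d (r * d) d (r * d)) (@mul_col_mx _ d (r * d)).
  by rewrite !mul0mx addr0 add0r e2 compan_cyc.
rewrite card_in_imset => [|[g2 w] [g2' w'] _ _ /eq_col_mx[/= ew ->]]; last first.
  by congr (_, _); have /(congr1 (row 0)) := ew; rewrite !rowK !mulmx1.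
transitivity (\sum_(g in intertwiners r x)
                \sum_(w : 'rV[F]_n | ~~ (w <= g)%MS) 1)%N.
  rewrite pair_big_dep -sum1_card; apply: eq_bigl => t.
  by rewrite inE.
rewrite -sum_nat_const; apply: eq_bigr => g; rewrite inE => /andP[gf _].
by rewrite -(card_notin_rowspace gf) -sum1_card; apply: eq_bigl => w; rewrite inE.
Qed.

(** Otherwise (n / d) d < n, so the product counting the independent families of n / d + 1 vectors
    is positive; but such a family has more than n independent rows. *)
Lemma annih_irred_dvd n x : x \in annih n P -> (d %| n)%N.
Proof.
move=> /annihP Px; apply: contraT => ndv.
have : (0 < #|intertwiners (n %/ d).+1 x|)%N.
  rewrite card_intertwiners // prodn_gt0 // => i.
  rewrite subn_gt0 ltn_exp2l ?finNzRing_gt1 //.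
  have := leq_trunc_div n d; rewrite leq_eqVlt -dvdn_eq (negbTE ndv) /=.
  by apply: leq_ltn_trans; rewrite leq_mul2r leq_ord orbT.
case/card_gt0P=> g; rewrite inE => /andP[/eqP gf _].
by have := rank_leq_col g; rewrite gf leqNgt ltn_ceil.
Qed.

(** Double count of the pairs (x, g) with g an intertwiner: in the square case g is invertible, and
    it determines x. *)
Lemma card_annih_irred k :
  (#|annih (k * d) P| * \prod_(i < k) (#|F| ^ (k * d) - #|F| ^ (i * d)))%N
  = #|GLset F (k * d)|.
Proof.
rewrite -sum_nat_const.
transitivity (\sum_(x in annih (k * d) P) \sum_(g in intertwiners k x) 1)%N.
  by apply: eq_bigr => x /annihP Px; rewrite sum1_card card_intertwiners.
rewrite (exchange_big_dep predT) //= -sum1_card [RHS]big_mkcond.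
apply: eq_bigr => g _; rewrite inE; case: ifP => gU.
  rewrite (big_pred1 (invmx g *m block_compan k *m g)) // => x.
  rewrite !inE row_free_unit gU /=.
  apply/andP/eqP => [[_ /eqP e]|->]; first by rewrite -mulmxA e mulKmx.
  rewrite peval_conj // peval_block_compan mulmx0 mul0mx eqxx.
  by rewrite -!mulmxA mulKVmx.
by rewrite big_pred0 // => x; rewrite !inE row_free_unit gU andbF.
Qed.

Lemma prod_expB_qpoch (Q : rat) k : Q != 0 ->
  \prod_(i < k) (Q ^+ k - Q ^+ i) = Q ^+ (k * k) * qpoch Q^-1 k.
Proof.
move=> Q0; rewrite (reindex_inj rev_ord_inj) /=.
rewrite (eq_bigr (fun i : 'I_k => Q ^+ k * (1 - Q^-1 ^+ i.+1))) => [|i _].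
  rewrite big_split /= prodr_const card_ord -exprM; congr (_ * _).
  by rewrite /qpoch big_add1 big_mkord.
rewrite mulrBr mulr1 exprVn; congr (_ - _); apply: (mulIf (expf_neq0 i.+1 Q0)).
by rewrite mulfVK ?expf_neq0 // -exprD subnK.
Qed.

Lemma annih_fps_irred : annih_fps P = gser #|F| d 0.
Proof.
apply: funext => n; rewrite /annih_fps /gser; case: ifP => [/dvdnP[k ->]|ndv].
  rewrite mulnK // mul0n addn0 -card_annih_irred natrM.
  have q0 : (#|F|%:R : rat) != 0.
    by rewrite pnatr_eq0 -lt0n ltnW // finNzRing_gt1.
  have pE : (\prod_(i < k) (#|F| ^ (k * d) - #|F| ^ (i * d)))%:R
            = (#|F|%:R : rat) ^+ (k * k * d) * qpoch (#|F|%:R ^+ d)^-1 k.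
    rewrite (mulnC (k * k)%N) exprM -prod_expB_qpoch ?expf_neq0 // natr_prod.
    apply: eq_bigr => i _.
    rewrite natrB ?leq_exp2l ?finNzRing_gt1 // ?leq_mul2r ?(ltnW (ltn_ord i)) ?orbT //.
    by rewrite !natrX -!exprM !(mulnC d).
  rewrite pE invfM mulrA divff ?mul1r //.
  (* The cancelled number of annihilated matrices is nonzero because it divides the order of GL. *)
  have : #|GLset F (k * d)| != 0%N.
    by rewrite -lt0n; apply/card_gt0P; exists 1%:M; rewrite inE unitmx1.
  by rewrite -card_annih_irred muln_eq0 pnatr_eq0 negb_or => /andP[].
rewrite (_ : annih n P = set0) ?cards0 ?mul0r //.
by apply/setP => x; rewrite [RHS]inE; apply/negP => /annih_irred_dvd; rewrite ndv.
Qed.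

End IrreducibleCount.

(** * Separable polynomials and products of distinct monic irreducibles *)

Section MonicIrreducibles.

Variable F : finFieldType.
Implicit Types (p P Q : {poly F}) (s : seq {poly F}).

Lemma natr_card : #|F|%:R = 0 :> F.
Proof.
have /expg_cardG : (1 : F) \in [set: F]%G by rewrite inE.
by rewrite FinRing.zmodXgE FinRing.zmod1gE cardsT.
Qed.

(* P divides 'X^N - 'X for N the order of the field F[X]/(P). *)
Lemma irreducible_separable P :
  P \is monic -> irreducible_poly P -> separable_poly P.
Proof.
move=> Pm Pirr; have hI : monic_irreducible_poly P by split.
pose N := #|{poly %/ P with hI}|.
have dvd : P %| 'X^N - 'X.
  have := @expf_card {poly %/ P with hI} (in_qpoly P 'X) => /eqP.
  have -> : (in_qpoly P 'X : {poly %/ P with hI}) ^+ N = in_qpoly P 'X^N.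
    by rewrite -[RHS]/(in_qpoly P _) rmorphXn.
  rewrite -subr_eq0 -[_ - _]/(in_qpoly P 'X^N - in_qpoly P 'X) -raddfB /=.
  by move/eqP/(congr1 val) => /= /eqP; rewrite -Pdiv.IdomainMonic.modpE ?mk_monicE.
(* N is a positive power of q, so the derivative of X^N - X is -1 and this polynomial is
   separable. *)
have N0 : N%:R = 0 :> F.
  rewrite /N card_qfpoly natrX natr_card expr0n.
  by case: Pirr => + _; case: (size P) => [|[|?]].
apply: dvdp_separable dvd _; rewrite unlock derivB derivX derivXn -mulr_natr.
rewrite -[N%:R]polyC_natr N0 mulr0 sub0r.
by rewrite -[X in coprimep _ X]scaleN1r coprimepZr ?oppr_eq0 ?oner_eq0 ?coprimep1.
Qed.

Definition monic_irred p := p \is monic /\ irreducible_poly p.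

Lemma monic_irred_coprime P Q :
  monic_irred P -> monic_irred Q -> P != Q -> coprimep P Q.
Proof.
move=> [Pm Pi] [Qm Qi] nPQ; apply: irredp_coprime => //.
apply: contraNN nPQ => dPQ; rewrite -eqp_monic //; apply: Qi => //.
by rewrite neq_ltn; case: Pi => ->; rewrite orbT.
Qed.

Lemma coprimep_prod_seq P s :
  {in s, forall Q, coprimep P Q} -> coprimep P (\prod_(Q <- s) Q).
Proof.
move=> cP; rewrite big_seq; elim/big_ind: _ => [|Q R cQ cR|]; last exact: cP.
  exact: coprimep1.
by rewrite coprimepMr cQ.
Qed.

Lemma separable_prod_irred s : uniq s -> {in s, forall p, monic_irred p} ->
  separable_poly (\prod_(p <- s) p).
Proof.
elim: s => [|P s IH] /=; first by rewrite big_nil unlock coprime1p.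
case/andP=> Ps us irr; have irrP : monic_irred P by apply: irr; rewrite mem_head.
have irrs : {in s, forall p, monic_irred p}.
  by move=> p ps; apply: irr; rewrite inE ps orbT.
rewrite big_cons separable_mul IH // irreducible_separable; try by case: irrP.
apply: coprimep_prod_seq => Q Qs; apply: monic_irred_coprime => //; first exact: irrs.
by apply: contraNneq Ps => ->.
Qed.

Lemma annih_fps_prod s : uniq s -> {in s, forall p, monic_irred p} ->
  annih_fps (\prod_(p <- s) p) =
  \big[fmul/fone]_(p <- s) gser #|F| (size p).-1 0.
Proof.
elim: s => [|P s IH] /=; first by rewrite !big_nil annih_fps1.
case/andP=> Ps us irr; have irrP : monic_irred P by apply: irr; rewrite mem_head.
have irrs : {in s, forall p, monic_irred p}.
  by move=> p ps; apply: irr; rewrite inE ps orbT.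
rewrite !big_cons annih_fpsM ?IH //; last first.
  apply: coprimep_prod_seq => Q Qs; apply: monic_irred_coprime => //; first exact: irrs.
  by apply: contraNneq Ps => ->.
case: irrP => Pm Pi; congr (fmul _ _).
case sP: (size P) => [|[|d']] /=; try by case: Pi; rewrite sP.
exact: annih_fps_irred.
Qed.

(** Strong induction on the size. A proper factorization of p has coprime factors by separability,
    so both divide the product and so does p; an irreducible p is associated to a member of s. *)
Lemma separable_dvd_prod s p :
  separable_poly p ->
  (forall P, monic_irred P -> P %| p -> P \in s) -> p %| \prod_(P <- s) P.
Proof.
have [k] := ubnP (size p); elim: k p => // k IH p; rewrite ltnS => lek sep irr.
have p0 := separable_poly_neq0 sep.
have [sp1 | sp1] := leqP (size p) 1.
  have /eqp_dvdl-> : p %= 1 by rewrite -size_poly_eq1 eqn_leq sp1 size_poly_gt0.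
  exact: dvd1p.
have [ir | nir] := asboolP (irreducible_poly p).
  have lc0 : (lead_coef p)^-1 != 0 by rewrite invr_eq0 lead_coef_eq0.
  pose P := (lead_coef p)^-1 *: p.
  have Pp : P %= p by rewrite eqp_scale.
  rewrite -(eqp_dvdl _ Pp) (big_rem P) ?dvdp_mulr //.
  apply: irr; last by rewrite (eqp_dvdl _ Pp).
  split; first by rewrite monicE lead_coefZ mulVf // lead_coef_eq0.
  split=> [|Q sQ]; first by rewrite size_scale.
  by rewrite (eqp_dvdr _ Pp) => Qp; rewrite (eqp_rtrans Pp) ir.2.
have [Q [sQ Qp nQp]] : exists Q, [/\ size Q != 1%N, Q %| p & ~~ (Q %= p)].
  apply: contrapT => nQ; apply: nir; split=> // Q sQ Qp.
  by apply: contrapT => /negP nQp; apply: nQ; exists Q.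
have [R pE] := dvdpP _ _ Qp.
have R0 : R != 0 by apply: contraNneq p0 => R0; rewrite pE R0 mul0r.
have Q0 : Q != 0 by apply: contraNneq p0 => Q0; rewrite pE Q0 mulr0.
have ltQ : (size Q < size p)%N by rewrite ltn_neqAle dvdp_leq // andbT dvdp_size_eqp.
have ltR : (size R < size p)%N.
  rewrite pE size_mul // -subn1 -addnBA ?size_poly_gt0 //.
  rewrite -[X in (X < _)%N]addn0 ltn_add2l.
  by rewrite subn_gt0 ltn_neqAle eq_sym sQ size_poly_gt0.
move: sep; rewrite pE separable_mul => /and3P[sR sQ' cRQ].
rewrite Gauss_dvdp // !IH // ?(leq_trans ltR) ?(leq_trans ltQ) //.
- by move=> P iP PR; apply: irr => //; rewrite pE dvdp_mull.
- by move=> P iP PR; apply: irr => //; rewrite pE dvdp_mulr.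
Qed.

End MonicIrreducibles.

(** * Lists of irreducibles by degree, and the semisimplicity criterion *)

Section IrreducibleLists.

Variable F : finFieldType.
Implicit Types (p P Q : {poly F}) (s : seq {poly F}).

Lemma monic_of_rVpoly d (c : {ffun 'I_d -> F}) :
  monic_of c = 'X^d + rVpoly (\row_i c i).
Proof.
rewrite /monic_of; congr (_ + _); rewrite /rVpoly poly_def.
by apply: eq_bigr => i _; rewrite valK mxE mul_polyC.
Qed.

Lemma size_monic_of d (c : {ffun 'I_d -> F}) : size (monic_of c) = d.+1.
Proof. by rewrite monic_of_rVpoly size_polyDl size_polyXn // ltnS size_poly. Qed.

Lemma monic_of_monic d (c : {ffun 'I_d -> F}) : monic_of c \is monic.
Proof.
rewrite monicE lead_coefE size_monic_of monic_of_rVpoly coefD coefXn eqxx /=.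
by rewrite nth_default ?addr0 // size_poly.
Qed.

Lemma monic_of_inj d : injective (@monic_of F d).
Proof.
move=> c c'; rewrite !monic_of_rVpoly => /addrI/(can_inj rVpolyK)/rowP e.
by apply/ffunP => i; have := e i; rewrite !mxE.
Qed.

Lemma monic_of_surj d p :
  p \is monic -> size p = d.+1 -> exists c : {ffun 'I_d -> F}, p = monic_of c.
Proof.
move=> pm sp; exists [ffun i : 'I_d => p`_i].
rewrite /monic_of -[LHS]coefK sp poly_def big_ord_recr /= addrC.
have -> : p`_d = 1 by move/monicP: pm; rewrite /lead_coef sp.
rewrite scale1r; congr (_ + _); apply: eq_bigr => i _.
by rewrite ffunE mul_polyC.
Qed.

Definition irrs d : seq {poly F} :=
  [seq monic_of c | c in [set c : {ffun 'I_d -> F} |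
                           `[< irreducible_poly (monic_of c) >]]].

Lemma mem_irrs d p :
  p \in irrs d <-> monic_irred p /\ size p = d.+1.
Proof.
split=> [/imageP[c]|[[pm pi] sp]].
  rewrite inE => /asboolP ci ->.
  by rewrite size_monic_of; split=> //; split=> //; apply: monic_of_monic.
have [c pc] := monic_of_surj pm sp.
by apply/imageP; exists c; rewrite // inE -pc; apply/asboolP.
Qed.

Lemma uniq_irrs d : uniq (irrs d).
Proof. by rewrite map_inj_uniq ?enum_uniq //; apply: monic_of_inj. Qed.

Lemma size_irrs d : size (irrs d) = Nirr F d.
Proof. by rewrite size_map -cardE. Qed.

Lemma monic_irred_XsubC (a : F) : monic_irred ('X - a%:P).
Proof. by split; [apply: monicXsubC | apply: irredp_XsubC]. Qed.

Definition irrs' d : seq {poly F} :=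
  [seq p <- irrs d | p \notin [:: 'X; 'X - 1%:P]].

(** In degree 1 the remaining polynomials are the X - a with a different from 0 and 1; in other
    degrees the filter removes nothing. *)
Lemma size_irrs' d : size (irrs' d) = Nirr' F d.
Proof.
rewrite /Nirr'; case: eqP => [-> | d1]; last first.
  rewrite -size_irrs size_filter; apply/eqP; rewrite -all_count; apply/allP => p.
  rewrite mem_irrs => -[_ sp]; rewrite !inE; apply/negP.
  by case/orP=> /eqP pE; apply: d1; move: sp; rewrite pE ?size_polyX ?size_XsubC => -[].
have -> : (#|F| - 2)%N = size [seq 'X - a%:P | a in ~: [set 0; 1 : F]].
  by rewrite size_map -cardE cardsCs setCK cards2 eq_sym oner_eq0.
apply: perm_size; apply: uniq_perm.
- by rewrite filter_uniq // uniq_irrs.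
- rewrite map_inj_uniq ?enum_uniq // => a b.
  by move=> /addrI/oppr_inj/polyC_inj.
move=> p; rewrite mem_filter; apply/andP/imageP => [[pn /mem_irrs[[pm _] sp]]|[a]].
  have pE : p = 'X - (- p`_0)%:P.
    rewrite polyCN opprK -[LHS]coefK sp poly_def big_ord_recr big_ord1 /= addrC.
    have -> : p`_1 = 1 by move/monicP: pm; rewrite /lead_coef sp.
    by rewrite scale1r -mul_polyC expr0 mulr1.
  exists (- p`_0) => //; rewrite !inE; apply: contra pn => a01.
  rewrite !inE pE; case/orP: a01 => /eqP ->; last by rewrite eqxx orbT.
  by rewrite subr0 eqxx.
rewrite !inE negb_or => /andP[a0 a1] ->; split.
  rewrite negb_or (inj_eq (addrI _)) eqr_opp (inj_eq (@polyC_inj _)) a1 andbT.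
  by rewrite -subr_eq0 addrAC subrr sub0r oppr_eq0 polyC_eq0.
by apply/mem_irrs; split; [apply: monic_irred_XsubC | rewrite size_XsubC].
Qed.

Definition irrs_upto m : seq {poly F} :=
  flatten [seq irrs' d | d <- index_iota 1 m.+1].

Lemma mem_irrs_upto m p : p \in irrs_upto m <->
  [/\ monic_irred p, (size p <= m.+1)%N, p != 'X & p != 'X - 1%:P].
Proof.
split=> [/flatten_mapP[d]|[pi sp pX pX1]].
  rewrite mem_index_iota mem_filter !inE negb_or => /andP[d1 dm].
  by case/andP=> /andP[pX pX1] /mem_irrs[pi sp]; split; rewrite ?sp.
apply/flatten_mapP; exists (size p).-1.
  case: pi => _ [s1 _]; rewrite mem_index_iota.
  by case: (size p) s1 sp => [|[|?]].
rewrite mem_filter !inE negb_or pX pX1 /=; apply/mem_irrs; split=> //.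
by rewrite prednK //; case: pi => _ [/ltnW].
Qed.

Lemma uniq_irrs_upto m : uniq (irrs_upto m).
Proof.
have: uniq (index_iota 1 m.+1) by apply: iota_uniq.
rewrite /irrs_upto; elim: (index_iota _ _) => //= d r IH.
case/andP=> dr ur; rewrite cat_uniq IH // andbT filter_uniq ?uniq_irrs //=.
apply/hasPn => p /flatten_mapP[d' d'r]; rewrite mem_filter => /andP[_ /mem_irrs[_ sp']].
apply/negP; rewrite mem_filter => /andP[_ /mem_irrs[_ sp]].
by move/negP: dr; apply; move: sp'; rewrite sp => -[->].
Qed.

Lemma irrs_upto_irred m : {in irrs_upto m, forall p, monic_irred p}.
Proof. by move=> p /mem_irrs_upto[]. Qed.

(** The polynomial X - 1 is kept apart at the head because only its factor differs between GL and
    the affine group. *)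
Definition irrs_unit m := 'X - 1%:P :: irrs_upto m.

Lemma uniq_irrs_unit m : uniq (irrs_unit m).
Proof.
rewrite /= uniq_irrs_upto andbT; apply/negP => /mem_irrs_upto[_ _ _].
by rewrite eqxx.
Qed.

Lemma irrs_unit_irred m : {in irrs_unit m, forall p, monic_irred p}.
Proof.
by move=> p; rewrite inE => /predU1P[->|/irrs_upto_irred //]; apply: monic_irred_XsubC.
Qed.

Lemma coprime_XsubC1_prod m :
  coprimep ('X - 1%:P) (\prod_(p <- irrs_upto m) p).
Proof.
apply: coprimep_prod_seq => p /mem_irrs_upto[pi _ _ pX1].
by apply: monic_irred_coprime; rewrite // 1?eq_sym //; apply: monic_irred_XsubC.
Qed.

Lemma coprimeX_prod m : coprimep 'X (\prod_(p <- irrs_unit m) p).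
Proof.
have iX : monic_irred ('X : {poly F}).
  by have := monic_irred_XsubC 0; rewrite subr0.
apply: coprimep_prod_seq => p; rewrite inE => /predU1P[-> | /mem_irrs_upto[pi _ pX _]].
  by rewrite coprimep_XsubC rootX oner_eq0.
by apply: monic_irred_coprime; rewrite // eq_sym.
Qed.

(** The factor of an irreducible depends only on its degree, so grouping by degree yields the
    powers. *)
Lemma annih_fps_irrs_upto m :
  annih_fps (\prod_(p <- irrs_upto m) p) =
  \big[fmul/fone]_(1 <= d < m.+1) fpow (gser #|F| d 0) (Nirr' F d).
Proof.
rewrite annih_fps_prod ?uniq_irrs_upto //; last exact: irrs_upto_irred.
rewrite big_flatten big_map; apply: eq_bigr => d _.
rewrite -size_irrs' /fpow -(count_predT (irrs' d)) -big_const_seq.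
apply: eq_big_seq => p; rewrite mem_filter => /andP[_ /mem_irrs[_ ->]] //.
Qed.

Lemma annih_fps_irrs_unit m :
  annih_fps (\prod_(p <- irrs_unit m) p) =
  fmul (gser #|F| 1 0) (annih_fps (\prod_(p <- irrs_upto m) p)).
Proof.
rewrite big_cons annih_fpsM ?coprime_XsubC1_prod //; congr (fmul _ _).
have [Xm Xi] := monic_irred_XsubC 1.
by rewrite (@annih_fps_irred _ 0) // size_XsubC.
Qed.

Lemma diagonalizable_dim0 (K : fieldType) (x : 'M[K]_0) : diagonalizable x.
Proof. by rewrite [x]thinmx0; apply: diagonalizable0. Qed.

(** Semisimple means separable minimal polynomial, and invertible means that X does not divide it.
    Its irreducible factors have degree at most n, so the bound m misses none of them. *)
Lemma unit_semisimple_annih m n (x : 'M[F]_n) : (n <= m)%N ->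
  (x \in unitmx) && semisimpleb x = (x \in annih n (\prod_(p <- irrs_unit m) p)).
Proof.
case: n x => [|n] x lenm.
  rewrite inE [peval _ _]thinmx0 eqxx unitmxE det_mx00 unitr1 /=.
  by apply/asboolP; apply: diagonalizable_dim0.
rewrite inE pevalE -dvd_mxminpoly.
have diagE : semisimpleb x <-> separable_poly (mxminpoly x).
  rewrite /semisimpleb; split=> [/asboolP/diagonalizableP[rs urs]|sep].
    rewrite mxminpoly_map => /dvdp_separable; rewrite separable_prod_XsubC.
    by move=> /(_ urs); rewrite separable_map.
  apply/asboolP/diagonalizableP; rewrite mxminpoly_map.
  have [rs rsE] := closed_field_poly_normal (map_poly (to_closure F) (mxminpoly x)).
  have := sep; rewrite -(separable_map (to_closure F)) rsE.
  rewrite lead_coef_map (monicP (mxminpoly_monic x)) rmorph1 scale1r.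
  by rewrite separable_prod_XsubC => urs; exists rs.
apply/andP/idP => [[xU /diagE sep]|dvd].
  apply: separable_dvd_prod => // P Pi Px.
  rewrite inE -implyNb; apply/implyP => PX1; apply/mem_irrs_upto; split=> //.
    rewrite (leq_trans (dvdp_leq _ Px)) ?monic_neq0 ?mxminpoly_monic //.
    rewrite (leq_trans (dvdp_leq _ (mxminpoly_dvd_char x))) ?size_char_poly //.
    by rewrite monic_neq0 // char_poly_monic.
  (* If X divided the minimal polynomial, 0 would be an eigenvalue of an invertible matrix. *)
  apply: contraTneq Px => ->.
  rewrite -['X]subr0 -polyC0 dvdp_XsubCl -eigenvalue_root_min.
  apply/negP => /eigenvalueP[v]; rewrite scale0r => vx /negP; apply.
  by rewrite -(mulmxK xU v) vx mul0mx.
split; last first.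
  apply/diagE; apply: dvdp_separable dvd _.
  by apply: separable_prod_irred; [apply: uniq_irrs_unit | apply: irrs_unit_irred].
have := @peval_coprime_unit _ _ (\prod_(p <- irrs_unit m) p) 'X x.
rewrite !pevalE horner_mx_X; apply; first by rewrite coprimep_sym coprimeX_prod.
by apply/eqP; rewrite -dvd_mxminpoly.
Qed.

End IrreducibleLists.

(** * The affine group and its weighted count *)

Section AffineGroup.

Variable F : finFieldType.
Implicit Types R : {poly F}.

Definition affine_mx n (t : 'rV[F]_n * 'M[F]_n) : 'M[F]_n.+1 :=
  block_mx (1%:M : 'M_1) t.1 0 t.2.

Lemma affine_mx_inj n : injective (@affine_mx n).
Proof. by move=> [b y] [b' y'] /(@eq_block_mx _ 1 n 1 n)[_ /= -> _ ->]. Qed.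

Lemma affine_mx_unit n (b : 'rV[F]_n) y :
  (affine_mx (b, y) \in unitmx) = (y \in unitmx).
Proof. by rewrite !unitmxE (@det_ublock _ 1 n) det1 mul1r. Qed.

Lemma Aset_affine n : Aset F n = [set affine_mx t | t in setX setT (GLset F n)].
Proof.
apply/setP => x; rewrite inE; apply/and3P/imsetP => [[xU /eqP x00 /forallP xj0]|].
  have xE : x = affine_mx (@ursubmx _ 1 n 1 n x, @drsubmx _ 1 n 1 n x).
    have eul : @ulsubmx _ 1 n 1 n x = 1%:M.
      apply/matrixP => i j; rewrite !mxE !ord1 eqxx /= mulr1n -[RHS]x00.
      by congr (x _ _); apply: val_inj.
    have edl : @dlsubmx _ 1 n 1 n x = 0.
      apply/matrixP => i j; rewrite !mxE ord1.
      have := xj0 (rshift 1 i); rewrite -val_eqE /= => /eqP <-.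
      by congr (x _ _); apply: val_inj.
    by rewrite -[LHS](@submxK _ 1 n 1 n) eul edl.
  exists (@ursubmx _ 1 n 1 n x, @drsubmx _ 1 n 1 n x) => //.
  by rewrite in_setX in_setT inE -(affine_mx_unit (@ursubmx _ 1 n 1 n x)) -xE.
move=> [[b y] /setXP[_]]; rewrite inE => yU ->; split.
- by rewrite affine_mx_unit.
- have -> : ord0 = lshift n (0 : 'I_1) by apply: val_inj.
  by rewrite /affine_mx (@block_mxEul _ 1 n 1 n) mxE.
- apply/forallP => j; apply/implyP => j0.
  have -> : ord0 = lshift n (0 : 'I_1) by apply: val_inj.
  case: (unliftP ord0 j) j0 => [i ->|->]; last by rewrite eqxx.
  have -> : lift ord0 i = rshift 1 i by apply: val_inj.
  by rewrite /affine_mx (@block_mxEdl _ 1 n 1 n) mxE.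
Qed.

Lemma card_Aset n : #|Aset F n| = (#|F| ^ n * #|GLset F n|)%N.
Proof.
rewrite Aset_affine card_imset; last exact: affine_mx_inj.
by rewrite cardsX cardsT card_mx mul1n.
Qed.

(* [1 b; 0 y] is conjugate to diag(1, y) by a unipotent matrix exactly when
   b lies in the row space of y - 1. *)
Lemma affine_mx_annih n R (b : 'rV[F]_n) y : coprimep ('X - 1%:P) R ->
  (affine_mx (b, y) \in annih n.+1 (('X - 1%:P) * R)) =
  (y \in annih n (('X - 1%:P) * R)) && (b <= y - 1%:M)%MS.
Proof.
move=> cR; set P := _ * R.
pose t : 'M[F]_(1 + n) := block_mx (1%:M : 'M_1) b 0 y.
change (affine_mx (b, y)) with t.
apply/annihP/andP => [Pt|[/annihP Py /submxP[c bE]]].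
  have ty : y *m row_mx 0 1%:M = row_mx (0 : 'M_(n, 1)) 1%:M *m t.
    by rewrite mul_mx_row mul_row_block !(mulmx0, mul0mx, mul1mx, mulmx1, add0r).
  have t1 : t *m col_mx (1%:M : 'M_1) 0 = col_mx 1%:M 0 *m 1%:M.
    by rewrite mul_block_col mul_col_mx !(mulmx0, mul0mx, mul1mx, mulmx1, addr0).
  split.
    apply/annihP; have := peval_intertwine P ty.
    rewrite [peval P t]Pt mulmx0 mul_mx_row mulmx0 mulmx1 -row_mx0.
    by case/eq_row_mx.
  have R1U : peval R (1%:M : 'M[F]_1) \in unitmx.
    by apply: peval_coprime_unit cR _; rewrite peval_XsubC subrr.
  (* Since P(t) = 0, [e] is fixed by t, and its first entry R(1) is invertible. The right block of e
     (t - 1) = 0 then expresses b through the rows of y - 1. *)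
  pose e := row_mx 1%:M (0 : 'M_(1, n)) *m peval R t.
  have e1 : lsubmx e = peval R (1%:M : 'M[F]_1).
    have : e *m col_mx 1%:M 0 = peval R (1%:M : 'M[F]_1).
      rewrite /e -mulmxA (peval_intertwine R t1) mulmxA mul_row_col.
      by rewrite mulmx1 mulmx0 addr0 mul1mx.
    by rewrite -{1}[e]hsubmxK mul_row_col mulmx1 mulmx0 addr0.
  have : e *m (t - 1%:M) = 0.
    rewrite /e -mulmxA -(peval_XsubC 1 t) pevalC -pevalM [peval _ t]Pt.
    by rewrite mulmx0.
  rewrite -[e]hsubmxK e1 /t scalar_mx_block opp_block_mx add_block_mx subrr !subr0.
  rewrite mul_row_block !mulmx0 addr0 -[0 in RHS]row_mx0 => /eq_row_mx[_ /eqP].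
  rewrite addr_eq0 => /eqP bE.
  by rewrite -(mulKmx R1U b) bE -mulNmx mulmxA submxMl.
pose u : 'M[F]_(1 + n) := block_mx (1%:M : 'M_1) (- c) 0 1%:M.
have uU : u \in unitmx by rewrite unitmxE (@det_ublock _ 1 n) !det1 mulr1 unitr1.
have : block_mx (1%:M : 'M_1) 0 0 y *m u = u *m t.
  rewrite !mulmx_block !(mulmx0, mul0mx, mul1mx, mulmx1, addr0, add0r).
  by rewrite bE mulmxBr mulmx1 mulNmx addrAC subrr add0r.
move/(peval_intertwine P); rewrite peval_diag Py.
have -> : peval P (1%:M : 'M[F]_1) = 0.
  by rewrite pevalM peval_XsubC subrr mul0mx.
by rewrite block_mx0 mul0mx => /(congr1 (mulmx (invmx u))); rewrite mulKmx // mulmx0.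
Qed.

Lemma card_affine_annih n R : coprimep ('X - 1%:P) R ->
  #|[set t : 'rV[F]_n * 'M[F]_n | affine_mx t \in annih n.+1 (('X - 1%:P) * R)]|
  = (\sum_(y in annih n (('X - 1%:P) * R)%R) #|F| ^ \rank (y - 1%:M)%R)%N.
Proof.
move=> cR.
rewrite -sum1_card (eq_bigl (fun t : 'rV[F]_n * 'M[F]_n =>
  (true && ((t.2 \in annih n (('X - 1%:P) * R)) && (t.1 <= t.2 - 1%:M)%MS)))); last first.
  by move=> [b y]; rewrite inE affine_mx_annih.
rewrite -(pair_big_dep predT (fun b y =>
  (y \in annih n (('X - 1%:P) * R)) && (b <= y - 1%:M)%MS) (fun _ _ => 1%N)) /=.
rewrite (exchange_big_dep (mem (annih n (('X - 1%:P) * R)))) /=; last first.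
  by move=> b y _ /andP[].
apply: eq_bigr => y yP; rewrite -card_rowg -sum1_card; apply: eq_bigl => b.
by rewrite yP inE.
Qed.

(** The weighted sum splits between X - 1 and R; the weight depends only on the size k of the block
    killed by X - 1. *)
Lemma ss_A_split n R : coprimep ('X - 1%:P) R ->
  (\sum_(y in annih n (('X - 1%:P) * R)%R) #|F| ^ \rank (y - 1%:M)%R)%N%:R
    / (#|F| ^ n * #|GLset F n|)%N%:R
  = fmul (gser #|F| 1 1) (annih_fps R) n.
Proof.
move=> cR; set q := #|F|.
have q0 : (q%:R : rat) != 0.
  by rewrite pnatr_eq0 -lt0n ltnW // finNzRing_gt1.
(* Proportion of the rows b that lie in the row space of y - 1. *)
pose w n (y : 'M[F]_n) : rat := q%:R ^+ \rank (y - 1%:M) / q%:R ^+ n.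
have wJ k (x g : 'M[F]_k) : g \in unitmx -> w k (invmx g *m x *m g) = w k x.
  move=> gU; rewrite /w; congr (_ ^+ _ / _).
  have -> : invmx g *m x *m g - 1%:M = invmx g *m (x - 1%:M) *m g.
    by rewrite mulmxBr mulmxBl mulmx1 mulVmx.
  by rewrite mxrankMfree ?row_free_unit // eqmxMfull ?row_full_unit ?unitmx_inv.
transitivity ((\sum_(y in annih n (('X - 1%:P) * R)) w n y) / #|GLset F n|%:R).
  rewrite -mulr_suml natrM natr_sum natrX invfM mulrA; congr (_ / _ / _).
  by apply: eq_bigr => y _; rewrite natrX.
rewrite sum_annih_split //; apply: eq_bigr => k _.
have [Xm Xi] := monic_irred_XsubC (1 : F).
have -> : gser q 1 1 k = annih_fps ('X - 1%:P : {poly F}) k / q%:R ^+ k.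
  rewrite (@annih_fps_irred _ 0) ?size_XsubC // /gser dvd1n divn1 mul1n mul0n addn0.
  by rewrite exprD mulrAC invfM.
rewrite /annih_fps [_ / _ / _]mulrAC mulf_div; congr (_ / _).
transitivity (\sum_(y in annih k ('X - 1%:P : {poly F}))
                \sum_(z in annih (n - k) R) (q%:R : rat) ^- k).
  (* Here y is the identity, and z - 1 is invertible because R kills z. The rank is thus n - k and
     the weight q^-k, which is what [e = 1] contributes in [gser]. *)
  apply: eq_bigr => y /annihP; rewrite peval_XsubC => y1.
  apply: eq_bigr => z /annihP zR; rewrite /w.
  have -> : block_mx y 0 0 z - 1%:M = block_mx 0 0 0 (z - 1%:M).
    by rewrite scalar_mx_block opp_block_mx add_block_mx y1 !subr0.
  rewrite rank_diag_block_mx mxrank0 add0n mxrank_unit.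
    by rewrite exprD invfM mulrCA divff ?mulr1 // expf_neq0.
  by rewrite -peval_XsubC; apply: peval_coprime_unit zR; rewrite coprimep_sym.
by rewrite !sumr_const -mulrnA -[LHS]mulr_natl mulnC natrM [RHS]mulrAC.
Qed.

Lemma ss_GL_annih n m : (n <= m)%N ->
  ss_GL F n = annih_fps (\prod_(p <- irrs_unit F m) p) n.
Proof.
move=> lenm; rewrite /ss_GL /annih_fps; congr (_%:R / _).
by apply: eq_card => x; rewrite -(unit_semisimple_annih x lenm) !inE.
Qed.

(** The bound is strict because elements of A(n,q) are matrices of dimension n + 1. *)
Lemma ss_A_annih n m : (n < m)%N ->
  ss_A F n = fmul (gser #|F| 1 1) (annih_fps (\prod_(p <- irrs_upto F m) p)) n.
Proof.
move=> ltnm; have cR := coprime_XsubC1_prod F m.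
rewrite -ss_A_split // -card_affine_annih // -card_Aset; congr (_%:R / _).
have -> : ('X - 1%:P) * \prod_(p <- irrs_upto F m) p = \prod_(p <- irrs_unit F m) p.
  by rewrite /irrs_unit big_cons.
rewrite -(card_imset _ (@affine_mx_inj n)).
apply: eq_card => x; rewrite inE Aset_affine.
apply/andP/imsetP => [[/imsetP[[b y] /setXP[_ yU] ->] ss]|[[b y]]].
  exists (b, y) => //; rewrite inE -unit_semisimple_annih // ss andbT.
  by rewrite affine_mx_unit; rewrite inE in yU.
rewrite inE -unit_semisimple_annih // affine_mx_unit => /andP[yU ss] ->.
by split=> //; apply/imsetP; exists (b, y) => //; rewrite in_setX in_setT inE.
Qed.

End AffineGroup.

(** * The two expressions for the affine series, obtained from truncated products *)

Theorem theorem5p9 (F : finFieldType) :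
  let q := #|F| in
  let SSA : fps := fun n => ss_A F n in
  let SSGL : fps := fun n => ss_GL F n in
  let S1 : fps := gser q 1 1 in
  let S0 : fps := gser q 1 0 in
  (* SS_A = S1 * prod_{d>=1} (gser q d 0)^{N'(d,q)} *)
  fps_lim (fun m => fmul S1 (\big[fmul/fone]_(1 <= d < m.+1)
                                fpow (gser q d 0) (Nirr' F d)))
          SSA
  /\
  (* SS_A = (S1 / S0) * SS_GL *)
  (forall n, SSA n = fmul (fmul S1 (fps_inv S0)) SSGL n).
Proof.
move=> q SSA SSGL S1 S0; split=> [n|n].
  by exists n.+1 => m ltnm; rewrite -annih_fps_irrs_upto -ss_A_annih.
(* Up to degree n, [SSGL] coincides with [fmul S0 G], and [S0] cancels against its inverse, leaving
   the truncated form of the first identity. *)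
pose G := annih_fps (\prod_(p <- irrs_upto F n.+1) p).
rewrite (@eq_fmul _ (fmul S1 (fps_inv S0)) SSGL (fmul S0 G)) // => [|i lein].
  rewrite fmulA -(fmulA S1) (fmulC _ S0) fmul_inv ?(fmulC S1) ?fmul1f.
    exact: ss_A_annih.
  (* The constant coefficient of [S0] is 1, so the inverse is genuine. *)
  by rewrite /S0 /gser dvdn0 div0n /qpoch big_geq // mulr1 expr0 invr1 oner_eq0.
by rewrite /SSGL (ss_GL_annih F (leqW lein)) annih_fps_irrs_unit.
Qed.
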